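(* Let $S$ be a countable iLWF semigroup (in particular, $S$ is an inverse semigroup) with a finite number of idempotents. Then $S$ is iLEF.
   Context: Maps are written on the right. A semigroup $S$ is inverse if for every $x\in S$ there is a unique $y\in S$, denoted $x^{-1}$, with $xyx=x$ and $yxy=y$. An inverse semigroup $S$ is iLEF (locally embeddable into the class of finite inverse semigroups) if for every finite subset $H$ of $S$ there exist a finite inverse semigroup $F$ and an injective function $f:H\to F$ such that for all $x,y\in H$ with $xy\in H$ one has $(xy)f=(xf)(yf)$. An inverse semigroup $S$ is iLWF (locally wrapped by the class of finite inverse semigroups) if for every finite subset $H$ of $S$ there exist a finite inverse semigroup $D$ and a function $d:D\to S$ such that $H\subseteq Dd$ and for all $x',y'\in D$ with $x'd,\,y'd\in H$ one has $(x'y')d=(x'd)(y'd)$. *)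

(* Defs.v *)
(* MathComp, with the classical sets and cardinality of MathComp-Analysis *)
From HB Require Import structures.
From mathcomp Require Import all_boot.
From mathcomp Require Import finmap.
From mathcomp Require Import boolp classical_sets functions cardinality.

Set Implicit Arguments.
Unset Strict Implicit.
Unset Printing Implicit Defensive.

Local Open Scope group_scope.
Local Open Scope fset_scope.
Local Open Scope classical_set_scope.

Definition inverse_semigroup (S : semigroupType) : Prop :=
  forall x : S, exists! y : S, x * y * x = x /\ y * x * y = y.

Definition idempotents (S : semigroupType) : set S := [set e | e * e = e].

Arguments idempotents : clear implicits.

(* [f] is a function on the finite subset [H] only; [[` xyH]] is the product
   [\val x * \val y] seen as an element of [H]. *)
Definition iLEF (S : semigroupType) : Prop :=
  inverse_semigroup S /\
  forall H : {fset S},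
    exists F : semigroupType,
      [/\ inverse_semigroup F, finite_set [set: F] &
        exists f : H -> F,
          injective f /\
          forall (x y : H) (xyH : \val x * \val y \in H),
            f [` xyH] = f x * f y].

Definition iLWF (S : semigroupType) : Prop :=
  inverse_semigroup S /\
  forall H : {fset S},
    exists D : semigroupType,
      [/\ inverse_semigroup D, finite_set [set: D] &
        exists d : D -> S,
          [set` H] `<=` range d /\
          forall x' y' : D, d x' \in H -> d y' \in H ->
            d (x' * y') = d x' * d y'].

(* Main.v *)
Require Import Defs.
From HB Require Import structures.
From mathcomp Require Import all_boot.
From mathcomp Require Import finmap.
From mathcomp Require Import boolp classical_sets functions cardinality.

Set Implicit Arguments.
Unset Strict Implicit.
Unset Printing Implicit Defensive.

Local Open Scope group_scope.

(** In an inverse semigroup [S] put [dom x = x^-1 x] and [ran x = x x^-1]; the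
    elements of [S] form a groupoid whose objects are the idempotents, with [x]
    running from [dom x] to [ran x] and with the product [a b] restricted to
    the pairs such that [dom a = ran b]. The semigroup is recovered from its
    groupoid: [h] is determined by its restrictions [h i], for [i] an
    idempotent below [dom h]. When there are finitely many idempotents this
    reduces a local embedding of [S] to one of its groupoid, and a groupoid
    with finitely many objects behaves like a group, for which wrapping and
    embedding are equivalent: in a finite group wrapping a finite symmetric part
    of a group [G], the fibre of the identity of [G] is a subgroup, normal in
    the subgroup generated by the wrapping elements, and is divided out.

    The groupoid version of this quotient is built inside the power set of the
    wrapping semigroup [D], given with [d : D -> S] which is multiplicative over
    a finite subset [K] of [S]. The fibre of an idempotent [e] is a finite
    semigroup, which contains an idempotent [m e] that is the only idempotent
    of its local monoid at [m e]; this monoid is then a group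
    ([closed_has_local_group]), and is the vertex group to be killed. The class
    of [a] is [coset a], the elements [z] of the fibre of [a] with
    [m (ran a) z = z = z m (dom a)]. These classes multiply as they should,
    [coset a * coset b = coset (a b)] when [dom a = ran b] ([coset_mul]), and
    they are nonempty and pairwise disjoint, lying in different fibres.

    Finally [h] acts on the finite set of pairs [(i, A)], [i] an idempotent of
    [S] and [A] a subset of [D] with [coset i * A = A], by
      [(i, A) |-> (h i h^-1, coset (h i) * A)]   whenever [i <= dom h].
    This is the action of the groupoid by translations, so it is by partial
    injections ([act_partial_injective]), is multiplicative ([actM]) and is
    faithful ([act_injective]). It embeds the given finite subset of [S] in a
    finite symmetric inverse semigroup. The set [K] must contain the elements
    [h i], their inverses and all the idempotents: this is a finite set because
    the idempotents are finite in number. *)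

(** * Finite semigroups *)

#[short(type="finSemigroupType")]
HB.structure Definition FinSemigroup := {G of Semigroup G & Finite G}.

(** Stated as an equality of semigroups, so that any data on [D] can be moved to
    [D'] by rewriting, without an isomorphism to carry along. *)
Lemma finite_semigroup_finType (D : semigroupType) :
  finite_set [set: D]%classic -> exists D' : finSemigroupType, D = D'.
Proof.
case: D => T [c1 c2 c3 c4]; set D := Semigroup.Pack _ => /finite_fsetP[X DX].
have memX (x : D) : x \in X by have : [set` X]%classic x by rewrite -DX.
pose f (x : D) : X := [` memX x]%fset.
have fK : cancel f val by [].
pose m1 := CanIsCountable fK.
have ax : Finite.axiom X by move=> x; rewrite count_uniq_mem ?fset_uniq // memX.
pose m2 := isFinite.Build D ax.
pose D' : finSemigroupType := HB.pack D m1 m2.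
by exists D'.
Qed.

Section FiniteSemigroups.
Variable D : finSemigroupType.
Implicit Types (T : {set D}) (x y : D).

(** By descent on subsemigroups: unless [T] can be replaced by a smaller one,
    [x T = T], so that the stabiliser [{y | x y = x}] of [x] in [T] is
    nonempty; being itself all of [T], it contains [x]. *)
Lemma closed_has_idempotent T x :
  x \in T -> {in T &, forall y z, y * z \in T} ->
  exists2 e, e \in T & e * e = e.
Proof.
have [n] := ubnP #|T|; elim: n T x => // n IHn T x; rewrite ltnS => leTn xT TM.
have IH (U : {set D}) y : U \subset T -> U != T -> y \in U ->
    {in U &, forall y z, y * z \in U} -> exists2 e, e \in T & e * e = e.
  move=> UT neU yU UM; have ltU : #|U| < #|T|.
    by apply: proper_card; rewrite finset.properEneq neU.
  have [e eU ee] := IHn U y (leq_trans ltU leTn) yU UM.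
  by exists e => //; apply: (fintype.subsetP UT).
have [xTT|xTT] := eqVneq [set x * y | y in T]%SET T; last first.
  apply: (IH _ (x * x) _ xTT).
  - by apply/fintype.subsetP => _ /imsetP[y yT ->]; apply: TM.
  - exact: imset_f.
  - move=> _ _ /imsetP[y yT ->] /imsetP[z zT ->].
    by rewrite -mulgA imset_f // !TM.
have [UT|UT] := eqVneq [set y in T | x * y == x]%SET T.
  by exists x => //; move: xT; rewrite -{1}UT inE => /andP[_ /eqP].
have /imsetP[y yT xy] : x \in [set x * y | y in T]%SET by rewrite xTT.
apply: (IH _ y _ UT).
- by apply/fintype.subsetP => z; rewrite inE => /andP[].
- by rewrite inE yT -xy eqxx.
- move=> z t; rewrite !inE => /andP[zT /eqP xz] /andP[tT /eqP xt].
  by rewrite TM //= mulgA xz xt.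
Qed.

(** The conclusion says that the local monoid of [T] at [m], of the [t] such that
    [m t = t = t m], is a group. For [m] one takes an idempotent with the fewest
    elements in its right ideal [m D] = [{y | m y = y}], which makes [m] the only idempotent of
    its local monoid [N]; for [t] in [N] the subsemigroup [t N] contains an
    idempotent, hence contains [m]. *)
Lemma closed_has_local_group T x :
  x \in T -> {in T &, forall y z, y * z \in T} ->
  exists m, [/\ m \in T, m * m = m &
    forall t, t \in T -> m * t = t -> t * m = t ->
      exists2 w, w \in T & [/\ m * w = w, w * m = w & t * w = m]].
Proof.
move=> xT TM; have [e eT ee] := closed_has_idempotent xT TM.
pose P m := (m \in T) && (m * m == m).
have Pe : P e by rewrite /P eT ee eqxx.
case: (arg_minnP (fun m => #|[set y | m * y == y]%SET|) Pe).
move=> m /andP[mT /eqP mm] m_min.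
have m_prim f : f \in T -> f * f = f -> m * f = f -> f * m = f -> f = m.
  move=> fT ff mf fm.
  have sub : [set y | f * y == y]%SET \subset [set y | m * y == y]%SET.
    by apply/fintype.subsetP => y; rewrite !inE => /eqP <-; rewrite mulgA mf.
  have /eqP eqfm : [set y | f * y == y]%SET == [set y | m * y == y]%SET.
    by rewrite eqEcard sub m_min // /P fT ff eqxx.
  have : m \in [set y | f * y == y]%SET by rewrite eqfm inE mm.
  by rewrite inE fm => /eqP.
exists m; split=> // t tT mt tm.
pose N := [set y in T | (m * y == y) && (y * m == y)]%SET.
have NM y z : y \in N -> z \in N -> y * z \in N.
  rewrite !inE => /and3P[yT /eqP my /eqP ym] /and3P[zT /eqP mz /eqP zm].
  by rewrite TM //= mulgA my -mulgA zm !eqxx.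
have tN : t \in N by rewrite inE tT mt tm !eqxx.
have [||f] := @closed_has_idempotent [set t * y | y in N]%SET (t * t).
- exact: imset_f.
- move=> _ _ /imsetP[y yN ->] /imsetP[z zN ->].
  by rewrite -mulgA imset_f // !NM.
move=> /imsetP[w wN ->] ff.
have := NM _ _ tN wN; rewrite inE => /and3P[twT /eqP mtw /eqP twm].
move: wN; rewrite inE => /and3P[wT /eqP mw /eqP wm].
by exists w => //; split=> //; apply: m_prim.
Qed.

Definition mulS (A B : {set D}) : {set D} := [set x * y | x in A, y in B]%SET.

Lemma mulSA : associative mulS.
Proof.
move=> A B C; apply/setP => z; apply/imset2P/imset2P.
- case=> a _ aA /imset2P[b c bB cC ->] ->.
  by exists (a * b) c; rewrite ?mulgA //; apply: imset2_f.
- case=> _ c /imset2P[a b aA bB ->] cC ->.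
  by exists a (b * c); rewrite ?mulgA //; apply: imset2_f.
Qed.

End FiniteSemigroups.

(** * The symmetric inverse semigroup of a finite set *)

Lemma option_ext (T : Type) (u v : option T) :
  (forall c, u = Some c <-> v = Some c) -> u = v.
Proof.
by case: u => [c|] uv; [rewrite ((uv c).1 erefl)|case: v uv => // c /(_ c)[_ ->]].
Qed.

Section SymmetricInverseSemigroup.
Variable X : finType.

Definition partial_injective (f : X -> option X) :=
  forall a b c, f a = Some c -> f b = Some c -> a = b.

Record partial_injection := PartialInjection {
  pfun :> {ffun X -> option X};
  _ : `[< partial_injective pfun >] }.

HB.instance Definition _ := [isSub for pfun].
HB.instance Definition _ := [Finite of partial_injection by <:].

Lemma pinjP (f : partial_injection) : partial_injective f.
Proof. by case: f => f /= /asboolP. Qed.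

Lemma pinj_of_subproof (f : X -> option X) : partial_injective f ->
  `[< partial_injective [ffun x => f x] >].
Proof. by move=> fP; apply/asboolP => a b c; rewrite !ffunE; apply: fP. Qed.

Definition pinj_of f (fP : partial_injective f) : partial_injection :=
  PartialInjection (pinj_of_subproof fP).

Lemma pinj_ofE f (fP : partial_injective f) x : pinj_of fP x = f x.
Proof. by rewrite ffunE. Qed.

Lemma pinj_ext (f g : partial_injection) :
  (forall a c, f a = Some c <-> g a = Some c) -> f = g.
Proof. by move=> fg; apply/val_inj/ffunP => a; apply/option_ext => c. Qed.

Lemma pcomp_subproof (f g : partial_injection) :
  partial_injective (fun a => obind f (g a)).
Proof.
move=> a b c; case ga: (g a) => [a'|] //=; case gb: (g b) => [b'|] //= fa fb.
by have ab := pinjP fa fb; apply: (pinjP ga); rewrite ab.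
Qed.

Definition pcomp f g := pinj_of (@pcomp_subproof f g).

Lemma pcompE f g a : pcomp f g a = obind f (g a).
Proof. exact: pinj_ofE. Qed.

Lemma pcompP f g a c : pcomp f g a = Some c <->
  exists2 b, g a = Some b & f b = Some c.
Proof.
rewrite pcompE; split; first by case: (g a) => // b; exists b.
by case=> b -> /=.
Qed.

Lemma pcompA : associative pcomp.
Proof.
move=> f g h; apply/val_inj/ffunP => a; rewrite /= -!/(pfun _) !ffunE.
by case: (h a) => //= b; rewrite ffunE.
Qed.

HB.instance Definition _ := isSemigroup.Build partial_injection pcompA.

Lemma pinv_subproof (f : partial_injection) :
  partial_injective (fun b => [pick a | f a == Some b]).
Proof.
move=> a b c; case: pickP => // x /eqP fx [<-].
by case: pickP => // y /eqP fy [yx]; move: fy; rewrite yx fx => -[].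
Qed.

Definition pinv f := pinj_of (@pinv_subproof f).

Lemma pinvP f a b : pinv f b = Some a <-> f a = Some b.
Proof.
rewrite pinj_ofE; case: pickP => [x /eqP fx|nof]; split=> //.
- by case=> <-.
- by move=> fa; rewrite (pinjP fa fx).
- by move=> fa; have := nof a; rewrite fa eqxx.
Qed.

Lemma pinj_inverse_sub (f g : partial_injection) a b :
  f * g * f = f -> f a = Some b -> g b = Some a.
Proof.
move=> fgf fa; move: (fa); rewrite -{1}fgf => /pcompP[b' fa'].
move: fa'; rewrite fa => -[<-] /pcompP[x gb fx].
by rewrite (pinjP fa fx).
Qed.

Lemma pmul_pinv (f : partial_injection) : f * pinv f * f = f.
Proof.
apply: pinj_ext => a c; split.
- case/pcompP=> b fa /pcompP[x /pinvP fx fxc].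
  by rewrite fa -fxc fx.
- move=> fa; apply/pcompP; exists c => //.
  by apply/pcompP; exists a => //; apply/pinvP.
Qed.

Lemma pinvK : involutive pinv.
Proof.
move=> f; apply: pinj_ext => a c.
by split=> [/pinvP/pinvP|fa]; last exact/pinvP/pinvP.
Qed.

Lemma partial_injection_inverse : inverse_semigroup partial_injection.
Proof.
move=> f; exists (pinv f); split.
  by split; rewrite ?pmul_pinv // -{2}(pinvK f) pmul_pinv.
move=> g [fgf gfg]; apply: pinj_ext => a c; split.
- by move=> /pinvP; apply: pinj_inverse_sub.
- by move=> ga; apply/pinvP; apply: pinj_inverse_sub ga.
Qed.

End SymmetricInverseSemigroup.

(** * Algebra of inverse semigroups *)

Section InverseSemigroup.
Variables (S : semigroupType) (S_inv : inverse_semigroup S).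
Implicit Types x y e f : S.

Definition inv x : S := sval (cid (S_inv x)).

Definition ran x : S := x * inv x.
Definition dom x : S := inv x * x.

Lemma mulVK x : x * inv x * x = x.
Proof. by rewrite /inv; case: cid => y [[]]. Qed.

Lemma invMK x : inv x * x * inv x = inv x.
Proof. by rewrite /inv; case: cid => y [[]]. Qed.

Lemma inv_uniq x y : x * y * x = x -> y * x * y = y -> inv x = y.
Proof. by move=> xyx yxy; rewrite /inv; case: cid => z [_ ] /=; apply. Qed.

Lemma invK : involutive inv.
Proof. by move=> x; apply: inv_uniq; rewrite ?mulVK ?invMK. Qed.

Lemma inv_idem e : e * e = e -> inv e = e.
Proof. by move=> ee; apply: inv_uniq; rewrite !ee. Qed.

Lemma idem_ran x : ran x * ran x = ran x.
Proof. by rewrite /ran mulgA mulVK. Qed.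

Lemma idem_dom x : dom x * dom x = dom x.
Proof. by rewrite /dom mulgA invMK. Qed.

Lemma mul_ran x : ran x * x = x. Proof. exact: mulVK. Qed.
Lemma mul_dom x : x * dom x = x. Proof. by rewrite /dom mulgA mulVK. Qed.

(** Both [g] and [f g e] are inverses of [e f], where [g] is the inverse of
    [e f]; hence [g = f g e], from which [g] is idempotent, and so is its
    inverse [e f]. *)
Lemma idemM e f : e * e = e -> f * f = f -> (e * f) * (e * f) = e * f.
Proof.
move=> ee ff; set g := inv (e * f).
have efgef : e * (f * (g * (e * f))) = e * f.
  by have := mulVK (e * f); rewrite -/g !mulgA.
have gefg : g * (e * (f * g)) = g by have := invMK (e * f); rewrite -/g !mulgA.
have gefge : g * (e * (f * (g * e))) = g * e by rewrite -[in RHS]gefg -!mulgA.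
have ege : g = f * (g * e).
  apply: inv_uniq; rewrite -!mulgA.
    by rewrite (mulgA f f) ff (mulgA e e) ee efgef.
  by rewrite (mulgA e e) ee (mulgA f f) ff gefge.
have gg : g * g = g by rewrite {1 2}ege -!mulgA gefge -ege.
by rewrite -[e * f]invK -/g (inv_idem gg) gg.
Qed.

(** Products of idempotents being idempotent, [f e] is an inverse of [e f],
    as is [e f] itself. *)
Lemma idemC e f : e * e = e -> f * f = f -> e * f = f * e.
Proof.
move=> ee ff; rewrite -(inv_idem (idemM ee ff)); apply: inv_uniq.
- by rewrite !mulgA -(mulgA _ f f) ff -(mulgA _ e e) ee -mulgA idemM.
- by rewrite !mulgA -(mulgA _ e e) ee -(mulgA _ f f) ff -mulgA idemM.
Qed.

Lemma invM x y : inv (x * y) = inv y * inv x.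
Proof.
have P a b : a * b * (inv b * inv a) * (a * b) = a * b.
  have -> : a * b * (inv b * inv a) * (a * b) = a * (ran b * dom a) * b.
    by rewrite /ran /dom !mulgA.
  by rewrite (idemC (idem_ran b) (idem_dom a)) mulgA mul_dom -mulgA mul_ran.
by apply: inv_uniq => //; have := P (inv y) (inv x); rewrite !invK.
Qed.

Lemma ran_inv x : ran (inv x) = dom x. Proof. by rewrite /ran invK. Qed.
Lemma dom_inv x : dom (inv x) = ran x. Proof. by rewrite /dom invK. Qed.

Lemma ran_idem e : e * e = e -> ran e = e.
Proof. by move=> ee; rewrite /ran inv_idem. Qed.

Lemma dom_idem e : e * e = e -> dom e = e.
Proof. by move=> ee; rewrite /dom inv_idem. Qed.

Lemma ranM x y : ran (x * y) = x * ran y * inv x.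
Proof. by rewrite /ran invM !mulgA. Qed.

Lemma domM x y : dom (x * y) = inv y * dom x * y.
Proof. by rewrite /dom invM !mulgA. Qed.

Lemma ranM_eq x y : dom x = ran y -> ran (x * y) = ran x.
Proof. by move=> xy; rewrite ranM -xy mul_dom. Qed.

Lemma domM_eq x y : dom x = ran y -> dom (x * y) = dom y.
Proof. by move=> xy; rewrite domM xy -mulgA mul_ran. Qed.

Lemma ran_restr x e : e * e = e -> ran (x * e) = x * e * inv x.
Proof. by move=> ee; rewrite ranM ran_idem. Qed.

Lemma dom_restr x e : e * e = e -> dom x * e = e -> dom (x * e) = e.
Proof. by move=> ee xe; rewrite domM -mulgA xe inv_idem. Qed.

(** Conjugating [e <= dom x] by [x] and back gives [e], so that translations
    act injectively on the objects of the groupoid. *)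
Lemma restrVK x e : e * e = e -> dom x * e = e -> inv x * (x * e * inv x) * x = e.
Proof.
move=> ee xe; have -> : inv x * (x * e * inv x) * x = dom x * e * dom x.
  by rewrite /dom !mulgA.
by rewrite xe idemC ?idem_dom.
Qed.

Lemma idem_conj x e : e * e = e ->
  (x * e * inv x) * (x * e * inv x) = x * e * inv x.
Proof. by move=> ee; rewrite -ran_restr // idem_ran. Qed.

(** The domain of a composite: [x y] is defined at the object [e] exactly when
    [y] is defined at [e] and [x] at its image [y e y^-1]. *)
Lemma dom_mul_restr x y e : e * e = e ->
  dom (x * y) * e = e <->
  dom y * e = e /\ dom x * (y * e * inv y) = y * e * inv y.
Proof.
move=> ee; have yxe : dom (x * y) * e = inv y * (dom x * (y * e)).
  by rewrite domM -!mulgA.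
split=> [xye|[ye xye]]; last first.
  have yey : y * e * inv y * y = y * e.
    by rewrite -!mulgA -/(dom y) (idemC ee (idem_dom y)) ye.
  by rewrite -{2}(restrVK ee ye) -xye yxe -{1}yey !mulgA.
have ye : dom y * e = e by rewrite -xye yxe ![dom y * _]mulgA /dom invMK.
split=> //; rewrite -{2}xye yxe.
have -> : y * (inv y * (dom x * (y * e))) * inv y =
   (ran y * dom x) * (y * e * inv y) by rewrite /ran !mulgA.
rewrite (idemC (idem_ran y) (idem_dom x)) -[RHS]mulgA; congr (_ * _).
by rewrite !mulgA mul_ran.
Qed.

End InverseSemigroup.

(** * Cosets in a wrapping semigroup, and translations *)

Section Wrapping.
Variables (S : semigroupType) (S_inv : inverse_semigroup S).
Variables (D : finSemigroupType) (d : D -> S) (K : {fset S}).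
Hypothesis dM : forall x y, d x \in K -> d y \in K -> d (x * y) = d x * d y.
Hypothesis d_onto : forall a, a \in K -> exists x, d x = a.
Hypothesis K_idem : forall e : S, e * e = e -> e \in K.
Hypothesis K_inv : forall a, a \in K -> inv S_inv a \in K.

Local Notation inv := (inv S_inv).
Local Notation ran := (ran S_inv).
Local Notation dom := (dom S_inv).

(** [m e] is the identity of a maximal subgroup of the fibre of [e]: the last
    clause provides right inverses in the local monoid of the fibre at [m e]. *)
Definition local_identity (m : S -> D) := forall e, e * e = e ->
  [/\ d (m e) = e, m e * m e = m e &
    forall t, d t = e -> m e * t = t -> t * m e = t ->
      exists w, [/\ d w = e, m e * w = w, w * m e = w & t * w = m e]].

Lemma local_identity_exists : exists m, local_identity m.
Proof.
have mP x : exists m, x * x = x -> [/\ d m = x, m * m = m &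
    forall t, d t = x -> m * t = t -> t * m = t ->
      exists w, [/\ d w = x, m * w = w, w * m = w & t * w = m]].
  have [xx|xx] := pselect (x * x = x); last first.
    by have [m _] := d_onto (K_idem (idem_ran S_inv x)); exists m => /xx.
  have [t0 dt0] := d_onto (K_idem xx).
  have [||m [mT mm mG]] := @closed_has_local_group D [set t | d t == x]%SET t0.
  - by rewrite inE dt0.
  - move=> y z; rewrite !inE => /eqP dy /eqP dz.
    by rewrite dM ?dy ?dz ?xx // K_idem.
  exists m => _; move: mT; rewrite inE => /eqP dm; split=> // t dt mt tm.
  have [|w] := mG t _ mt tm; first by rewrite inE dt.
  by rewrite inE => /eqP dw [mw wm tw]; exists w.
by have [m] := choice mP; exists m.
Qed.

Variables (m : S -> D) (mP : local_identity m).

Let dm e : e * e = e -> d (m e) = e. Proof. by case/mP. Qed.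
Let mm e : e * e = e -> m e * m e = m e. Proof. by case/mP. Qed.
Let mG e t : e * e = e -> d t = e -> m e * t = t -> t * m e = t ->
  exists w, [/\ d w = e, m e * w = w, w * m e = w & t * w = m e].
Proof. by move=> /mP[_ _]; apply. Qed.

(** The part of the fibre of [a] that runs from the vertex [m (dom a)] to the
    vertex [m (ran a)]; for an idempotent [e], [coset e] is the group at [m e]. *)
Definition coset a : {set D} :=
  [set z | [&& m (ran a) * z == z, z * m (dom a) == z & d z == a]]%SET.

Lemma cosetP a z : reflect [/\ m (ran a) * z = z, z * m (dom a) = z & d z = a]
  (z \in coset a).
Proof.
by rewrite inE; apply: (iffP and3P) => [[/eqP ? /eqP ? /eqP]|[-> -> ->]].
Qed.

Lemma coset_neq0 a : a \in K -> exists z, z \in coset a.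
Proof.
move=> aK; have [z dz] := d_onto aK.
have rK := K_idem (idem_ran S_inv a); have lK := K_idem (idem_dom S_inv a).
have dzm : d (z * m (dom a)) = a.
  by rewrite dM ?dm ?dz ?mul_dom //; apply: idem_dom.
exists (m (ran a) * (z * m (dom a))); apply/cosetP; split.
- by rewrite mulgA mm //; apply: idem_ran.
- by rewrite -!mulgA mm //; apply: idem_dom.
- by rewrite dM ?dzm ?dm ?mul_ran //; apply: idem_ran.
Qed.

Lemma coset_mul_mem a b x y : a \in K -> b \in K -> dom a = ran b ->
  x \in coset a -> y \in coset b -> x * y \in coset (a * b).
Proof.
move=> aK bK ab /cosetP[mx xm dx] /cosetP[my ym dy]; apply/cosetP.
by rewrite ranM_eq // domM_eq // mulgA mx -mulgA ym dM ?dx ?dy.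
Qed.

(** For the inclusion from right to left, take [p] and [q] in the cosets of [a]
    and [a^-1]. Then [p q] is in the group [coset (ran a)], hence has a right
    inverse [w], and [z = p (q w z)] with [q w z] in the coset of
    [a^-1 (a b) = b]. *)
Lemma coset_mul a b : a \in K -> b \in K -> a * b \in K -> dom a = ran b ->
  mulS (coset a) (coset b) = coset (a * b).
Proof.
move=> aK bK abK ab; apply/setP => z; apply/imset2P/idP.
  by case=> x y xa yb ->; apply: coset_mul_mem.
move=> zab; have [p pa] := coset_neq0 aK.
have [q qa] := coset_neq0 (K_inv aK).
have ee := idem_ran S_inv a.
have /cosetP[] : p * q \in coset (ran a).
  by apply: coset_mul_mem; rewrite ?ran_inv ?K_inv.
rewrite ran_idem // dom_idem // => mpq pqm dpq.
have [w [dw mw wm pqw]] := mG ee dpq mpq pqm.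
have wa : w \in coset (ran a) by apply/cosetP; rewrite ran_idem // dom_idem.
exists p (q * (w * z)) => //.
  have -> : b = inv a * (ran a * (a * b)).
    by rewrite [ran a * _]mulgA mul_ran mulgA -/(dom a) ab mul_ran.
  have rab : ran (a * b) = ran a by rewrite ranM_eq.
  have e1 : ran a * (a * b) = a * b by rewrite mulgA mul_ran.
  apply: coset_mul_mem; rewrite ?K_inv ?e1 ?rab ?dom_inv // -e1.
  by apply: coset_mul_mem => //; [exact: K_idem | rewrite rab dom_idem].
rewrite !mulgA pqw; case/cosetP: zab => <- _ _.
by rewrite ranM_eq // mulgA mm.
Qed.

Variable E : {fset S}.
Hypothesis EP : forall e, (e \in E) = (e * e == e).

(** Subsets [A] with [coset i * A <> A] are left out of the domain: on the others
    the translation by the coset of [h i] is undone by that of its inverse. The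
    call to [insub] always succeeds, as [h i h^-1] is idempotent. *)
Definition act (h : S) (p : E * {set D}) : option (E * {set D}) :=
  let i := val p.1 in
  if (dom h * i == i) && (mulS (coset i) p.2 == p.2) then
    omap (fun j => (j, mulS (coset (h * i)) p.2)) (insub (h * i * inv h))
  else None.

Lemma actP h (p q : E * {set D}) : act h p = Some q <->
  [/\ dom h * val p.1 = val p.1, mulS (coset (val p.1)) p.2 = p.2,
     val q.1 = h * val p.1 * inv h & q.2 = mulS (coset (h * val p.1)) p.2].
Proof.
rewrite /act; case: ifPn => [/andP[/eqP hp /eqP pp]|]; last first.
  by move=> /negP np; split=> // -[hp pp _ _]; case: np; rewrite hp pp !eqxx.
split.
  by case: insubP => //= j _ jE [<-].
case=> _ _; case: q => j B /= <- ->.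
by rewrite valK.
Qed.

Let Eidem (i : E) : val i * val i = val i.
Proof. by apply/eqP; rewrite -EP fsvalP. Qed.

Definition restrictable (h : S) := forall e, e * e = e -> h * e \in K.

Lemma coset_inv_mul h i : i * i = i -> dom h * i = i -> h * i \in K ->
  mulS (coset (inv (h * i))) (coset (h * i)) = coset i.
Proof.
move=> ii hi hiK; rewrite coset_mul ?K_inv ?dom_inv // -/(dom _) dom_restr //.
exact: K_idem.
Qed.

Lemma act_partial_injective h : restrictable h -> partial_injective (act h).
Proof.
move=> hK [i A] [j B] q /actP[/= hi iA q1 q2] /actP[/= hj jB]; rewrite q1 q2.
move=> hij; have ij : i = j.
  by apply: val_inj; rewrite -(restrVK (Eidem i) hi) hij (restrVK (Eidem j) hj).
move: hj jB; rewrite -{j hij}ij => _ iB AB; congr (_, _).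
have hiK := hK _ (Eidem i).
by rewrite -iA -(coset_inv_mul (Eidem i) hi hiK) -mulSA AB mulSA coset_inv_mul.
Qed.

(** With [j = y i y^-1], the product [(x j) (y i) = x y i] is a product in the
    groupoid, so [coset_mul] applies; the domains agree by [dom_mul_restr]. *)
Lemma actM x y p : restrictable x -> restrictable y -> restrictable (x * y) ->
  act (x * y) p = obind (act x) (act y p).
Proof.
move=> xK yK xyK; case: p => i A; have ii := Eidem i.
set e := val i in ii; set j := y * e * inv y.
have jj : j * j = j by apply: idem_conj.
have jE : j \in E by rewrite EP jj.
have xyj : x * y * e * inv (x * y) = x * j * inv x by rewrite invM /j !mulgA.
have yeK : y * e \in K by apply: yK.
have jK : j \in K by apply: K_idem.
have ryj : ran (y * e) = j by rewrite ran_restr.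
have jye : j * (y * e) = y * e by rewrite -ryj mul_ran.
have cj : mulS (coset j) (mulS (coset (y * e)) A) = mulS (coset (y * e)) A.
  by rewrite mulSA coset_mul ?jye // ryj dom_idem.
have cx : dom x * j = j -> mulS (coset (x * j)) (mulS (coset (y * e)) A) =
    mulS (coset (x * y * e)) A.
  move=> xj; have xjye : x * j * (y * e) = x * y * e by rewrite -mulgA jye mulgA.
  rewrite mulSA coset_mul ?xjye //; [exact: xK|exact: xyK|].
  by rewrite ryj dom_restr.
have actyE : dom y * e = e -> mulS (coset e) A = A ->
    act y (i, A) = Some ([` jE]%fset, mulS (coset (y * e)) A).
  by move=> ye iA; apply/actP.
apply: option_ext => q; split.
- move=> /actP[/= xye iA q1 q2].
  have [ye xj] := (dom_mul_restr S_inv x y ii).1 xye.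
  by rewrite actyE //=; apply/actP; split=> //=; rewrite ?cx // -xyj.
- case yE : (act y (i, A)) => [r|] //= xr; have /actP[/= ye iA _ _] := yE.
  move: yE xr; rewrite actyE // => -[<-] /actP[/= xj _ q1 q2].
  apply/actP; split=> //=; rewrite ?q1 ?q2 ?cx ?xyj //.
  exact/dom_mul_restr.
Qed.

(** Applying both maps to the base point [(dom x, coset (dom x))] gives
    [coset x = coset (y dom x)], and nonempty cosets determine the element. The
    conclusion says that [x] is below [y] in the natural order. *)
Lemma act_eq_le x y : restrictable x -> restrictable y ->
  act x =1 act y -> y * dom x = x.
Proof.
move=> xK yK xy; have ii := idem_dom S_inv x.
have iE : dom x \in E by rewrite EP ii.
have rE : ran x \in E by rewrite EP idem_ran.
have xinK : x \in K by rewrite -(mul_dom S_inv x); apply: xK.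
have K_dom := K_idem ii.
have ax : act x ([` iE]%fset, coset (dom x)) = Some ([` rE]%fset, coset x).
  apply/actP; split=> //=; first by rewrite coset_mul ?ii // dom_idem // ran_idem.
    by rewrite mul_dom.
  by rewrite coset_mul ?mul_dom // ran_idem.
move: (ax); rewrite xy => /actP[/= yx _ _ cxy].
have cyx : coset x = coset (y * dom x).
  have yxx : y * dom x * dom x = y * dom x by rewrite -mulgA ii.
  rewrite cxy coset_mul ?yxx //; [exact: yK|exact: yK|].
  by rewrite dom_restr ?ran_idem.
have [z zx] := coset_neq0 xinK.
by move: (zx); rewrite {1}cyx => /cosetP[_ _ <-]; case/cosetP: zx.
Qed.

Lemma act_injective x y : restrictable x -> restrictable y ->
  act x =1 act y -> x = y.
Proof.
move=> xK yK xy; have xE := act_eq_le xK yK xy.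
have yE := act_eq_le yK xK (fsym xy).
rewrite -[LHS]xE -[y in LHS]yE -mulgA.
by rewrite (idemC S_inv (idem_dom S_inv y) (idem_dom S_inv x)) mulgA mul_dom.
Qed.

End Wrapping.

Theorem theorem2 (S : semigroupType)
    (S_countable : countable [set: S]%classic)
    (S_iLWF : iLWF S)
    (fin_idem : finite_set (idempotents S)) :
  iLEF S.
Proof.
case: S_iLWF => S_inv wrap; split=> // H.
have /finite_fsetP[E idemE] := fin_idem.
have EP e : (e \in E) = (e * e == e).
  apply/idP/eqP => [eE|ee].
    by have : idempotents S e by rewrite idemE.
  by have : [set` E]%classic e by rewrite -idemE.
(* E is added so that K contains every idempotent e = e e. *)
pose L := [fset x * e | x in (H `|` E)%fset, e in E]%fset.
pose K := (L `|` [fset inv S_inv x | x in L])%fset.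
have LP (x e : S) : x \in (H `|` E)%fset -> e * e = e -> x * e \in K.
  move=> xHE ee; apply/fsetUP; left; apply: in_imfset2 => //=.
  by rewrite EP ee.
have K_idem (e : S) : e * e = e -> e \in K.
  by move=> ee; rewrite -ee; apply: LP => //; apply/fsetUP; right; rewrite EP ee.
have K_inv a : a \in K -> inv S_inv a \in K.
  case/fsetUP => [aL|/imfsetP[b /= bL ->]]; apply/fsetUP.
    by right; apply: in_imfset.
  by left; rewrite invK.
have H_restr (h : H) (e : S) : e * e = e -> val h * e \in K.
  by apply: LP; apply/fsetUP; left; apply: valP.
have [D [_ /finite_semigroup_finType[D' DD'] [d [d_onto dM]]]] := wrap K.
move: d d_onto dM; rewrite {D}DD' => d d_onto dM.
have {}d_onto a : a \in K -> exists x, d x = a.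
  by move=> /d_onto[x _ <-]; exists x.
have [m mP] := local_identity_exists S_inv dM d_onto K_idem.
pose f (h : H) := pinj_of
  (act_partial_injective dM d_onto K_idem K_inv mP EP (H_restr h)).
exists (partial_injection (E * {set D'})%type); split.
- exact: partial_injection_inverse.
- exact: finite_finset.
exists f; split=> [x y fxy|x y xyH].
  apply/val_inj/(act_injective dM d_onto K_idem K_inv mP EP (H_restr x)
    (H_restr y)) => p.
  by have := congr1 (fun g : partial_injection _ => g p) fxy; rewrite !pinj_ofE.
apply/val_inj/ffunP => p; rewrite [LHS]pinj_ofE [RHS]pcompE [f y p]pinj_ofE.
rewrite (actM dM d_onto K_idem K_inv mP EP p (H_restr x) (H_restr y)
           (H_restr [` xyH]%fset)).
by congr (obind _ _); apply/funext => q; rewrite pinj_ofE.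
Qed.
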